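(* Let $C$ be a clone of Boolean functions, and let $T$ be the class of all threshold functions. The class $C \cap T$ is finitely characterizable if and only if $C$ is contained in one of the clones $L$, $V$, $\Lambda$.
   Context: Let $\mathbb{B} = \{0,1\}$. A Boolean function is a map $f\colon \mathbb{B}^n \to \mathbb{B}$ with $n \ge 1$. A clone of Boolean functions is a set of Boolean functions containing all projections and closed under composition $f(g_1,\dots,g_n)(\mathbf{a}) = f(g_1(\mathbf{a}),\dots,g_n(\mathbf{a}))$. A Boolean function $f\colon\mathbb{B}^n\to\mathbb{B}$ is a threshold function if there are $w_1,\dots,w_n,t\in\mathbb{R}$ with $f(x_1,\dots,x_n)=1 \iff \sum_{i=1}^n w_i x_i \ge t$. An $m$-ary relational constraint is a pair $(R,S)$ with $R,S\subseteq\mathbb{B}^m$. A function $f\colon\mathbb{B}^n\to\mathbb{B}$ preserves $(R,S)$ if for all $\mathbf{a}^1,\dots,\mathbf{a}^n\in R$ the tuple $f(\mathbf{a}^1,\dots,\mathbf{a}^n)$, whose $i$-th entry is $f(a^1_i,\dots,a^n_i)$, lies in $S$. A set $\mathcal{F}$ of Boolean functions is finitely characterizable if there is a finite set $\mathcal{Q}$ of relational constraints (of any arities) such that $\mathcal{F}$ is exactly the set of Boolean functions preserving every member of $\mathcal{Q}$. $L$ is the clone of all linear functions $c_0\oplus c_1x_1\oplus\dots\oplus c_nx_n$ ($c_i\in\mathbb{B}$, $\oplus$ addition modulo 2); $\Lambda$ is the clone of all conjunctions $x_{i_1}\wedge\dots\wedge x_{i_r}$ of variables and all constant functions (of every arity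 $\geq 1$); $V$ is the clone of all disjunctions $x_{i_1}\vee\dots\vee x_{i_r}$ of variables and all constant functions. *)

(* Defs.v *)
From mathcomp Require Import all_boot all_order all_algebra.
From mathcomp Require Import reals.

Set Implicit Arguments.
Unset Strict Implicit.
Unset Printing Implicit Defensive.

Import Order.TTheory GRing.Theory Num.Theory.
Local Open Scope ring_scope.

Definition bvec (n : nat) := {ffun 'I_n -> bool}.

Definition boolfun (n : nat) := {ffun bvec n -> bool}.

(* Boolean functions have arity at least 1: the component of index [n] of a
   class consists of its members of arity [n.+1]. *)
Definition fclass := forall n : nat, boolfun n.+1 -> Prop.

Definition fsub (C D : fclass) : Prop :=
  forall (n : nat) (f : boolfun n.+1), C n f -> D n f.

Definition fcap (C D : fclass) : fclass := fun n f => C n f /\ D n f.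

Definition bproj (n : nat) (i : 'I_n) : boolfun n := [ffun x : bvec n => x i].

Definition bcomp (n m : nat) (f : boolfun n) (g : 'I_n -> boolfun m) :
    boolfun m :=
  [ffun a : bvec m => f [ffun i => g i a]].

Definition is_clone (C : fclass) : Prop :=
  (forall (n : nat) (i : 'I_n.+1), C n (bproj i)) /\
  (forall (n m : nat) (f : boolfun n.+1) (g : 'I_n.+1 -> boolfun m.+1),
     C n f -> (forall i, C m (g i)) -> C m (bcomp f g)).

Definition threshold (R : realType) : fclass := fun n f =>
  exists (w : 'I_n.+1 -> R) (t : R),
    forall x : bvec n.+1, f x <-> t <= \sum_(i < n.+1) w i * (x i)%:R.

(* Constraints of all arities, as triples: an arity [m] and two [m]-ary
   relations, the antecedent and the consequent. *)
Definition constraint := {m : nat & ({set bvec m} * {set bvec m})%type}.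

Definition preserves (n : nat) (f : boolfun n) (q : constraint) : Prop :=
  forall a : 'I_n -> bvec (tag q),
    (forall j, a j \in (tagged q).1) ->
    [ffun i => f [ffun j => a j i]] \in (tagged q).2.

Definition finitely_characterizable (F : fclass) : Prop :=
  exists Q : seq constraint,
    forall (n : nat) (f : boolfun n.+1),
      F n f <-> (forall q, q \in Q -> preserves f q).

Definition cloneL : fclass := fun n f =>
  exists (c0 : bool) (c : 'I_n.+1 -> bool),
    forall x : bvec n.+1,
      f x = c0 (+) \big[addb/false]_(i < n.+1) (c i && x i).

Definition is_const (n : nat) (f : boolfun n) : Prop :=
  exists b : bool, forall x : bvec n, f x = b.

Definition cloneLambda : fclass := fun n f =>
  is_const f \/
  exists s : seq 'I_n.+1, s != [::] /\
    forall x : bvec n.+1, f x = \big[andb/true]_(i <- s) x i.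

Definition cloneV : fclass := fun n f =>
  is_const f \/
  exists s : seq 'I_n.+1, s != [::] /\
    forall x : bvec n.+1, f x = \big[orb/false]_(i <- s) x i.

(* Main.v *)
Require Import Defs.
From mathcomp Require Import all_boot all_order all_algebra.
From mathcomp Require Import reals.
From mathcomp Require Import boolp zify.

(* Finite characterizability of a class closed under identification of
   variables means that membership is decided by the minors of some fixed
   arity N + 1.  Inside L, V and Lambda this holds with N = 2.

   Otherwise C contains the majority function, x && (y || z), or the dual of
   the latter.  For a K x K grid plus one extra variable, take a generic positive
   weighting for which, up to complements, the only sets of weight one half are
   the lines (a row or a column, together with the extra variable).  Decide the
   other sets by weight, and let rows win and columns lose.  The resulting
   monotone self-dual F is not threshold, because the rows and the columns have
   the same sum.  An identification to N + 1 variables with 2 ^ (N + 1) < K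
   misses at least one row, and then moving a little weight away from that row
   separates all the remaining ties, so the minor is threshold.  Finally F is in
   C, or x0 && F is in C or in its dual class, by the Baker-Pixley
   interpolation argument. *)

Set Implicit Arguments.
Unset Strict Implicit.
Unset Printing Implicit Defensive.

Import Order.TTheory GRing.Theory Num.Theory.
Local Open Scope ring_scope.

(** * Minors *)

Definition minor (n m : nat) (f : boolfun n) (tau : 'I_n -> 'I_m) : boolfun m :=
  [ffun y : bvec m => f [ffun j => y (tau j)]].

Definition minor_closed (F : fclass) : Prop :=
  forall (n m : nat) (f : boolfun n.+1) (tau : 'I_n.+1 -> 'I_m.+1),
    F n f -> F m (minor f tau).

Definition determined_by_minors (N : nat) (F : fclass) : Prop :=
  forall (n : nat) (f : boolfun n.+1),
    (forall tau : 'I_n.+1 -> 'I_N.+1, F N (minor f tau)) -> F n f.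

(** A constraint of arity m sees at most 2 ^ m distinct tuples. Identifying the variables of f that
    receive the same tuple gives a minor producing the same output tuple, so N only has to bound
    these numbers over [Q]. *)
Lemma finitely_characterizable_determined (F : fclass) :
  finitely_characterizable F -> exists N, determined_by_minors N F.
Proof.
case=> Q hQ; pose N := (\max_(q <- Q) #|{: bvec (tag q)}|)%N.
exists N => n f hf; apply/hQ => q qQ a aR.
have hN : (#|{: bvec (tag q)}| <= N)%N.
  by rewrite /N (big_rem q) //= leq_maxl.
pose tau (j : 'I_n.+1) : 'I_N.+1 := inord (enum_rank (a j)).
have tau_inj j j' : tau j = tau j' -> a j = a j'.
  move=> /(congr1 val); rewrite /= !inordK; last 2 first.
  - exact: leq_trans (ltn_ord _) (leqW hN).
  - exact: leq_trans (ltn_ord _) (leqW hN).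
  by move=> /val_inj /enum_rank_inj.
(* Variables outside the image of [tau] get the default [a ord0], which keeps every tuple in the
   antecedent. *)
pose a' k := if [pick j | tau j == k] is Some j then a j else a ord0.
have a'E j : a' (tau j) = a j.
  rewrite /a'; case: pickP => [j' /eqP /tau_inj //|/(_ j)].
  by rewrite eqxx.
have a'R k : a' k \in (tagged q).1.
  by rewrite /a'; case: pickP => [j' _|_]; apply: aR.
have /hQ/(_ q qQ a' a'R) := hf tau.
suff -> : [ffun i => minor f tau [ffun k => a' k i]] =
          [ffun i => f [ffun j => a j i]] :> bvec (tag q) by [].
apply/ffunP => i; rewrite !ffunE; congr (f _).
by apply/ffunP => j; rewrite !ffunE a'E.
Qed.

(** One constraint suffices: its antecedent holds the N + 1 columns of the input table, its
    consequent the value tables of the members of F of arity N + 1. Choosing antecedent tuples is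
    choosing [tau], and applying f to them gives the table of [minor f tau]. *)
Lemma determined_finitely_characterizable (N : nat) (F : fclass) :
  minor_closed F -> determined_by_minors N F -> finitely_characterizable F.
Proof.
move=> Fm FN.
pose M := #|{: bvec N.+1}|.
pose col (k : 'I_N.+1) : bvec M := [ffun i => (enum_val i : bvec N.+1) k].
pose untab (y : bvec M) : boolfun N.+1 := [ffun v => y (enum_rank v)].
pose q : constraint := existT (fun m => ({set bvec m} * {set bvec m})%type) M
  ([set col k | k in [set: 'I_N.+1]], [set y | `[< F N (untab y) >]]).
have key n (f : boolfun n.+1) (tau : 'I_n.+1 -> 'I_N.+1) :
    untab [ffun i => f [ffun j => col (tau j) i]] = minor f tau.
  apply/ffunP => y; rewrite !ffunE; congr (f _).
  by apply/ffunP => j; rewrite !ffunE enum_rankK.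
exists [:: q] => n f; split=> [Ff q'|hf].
  rewrite inE => /eqP -> a aR.
  have /choice[tau tauE] : forall j, exists k, a j = col k.
    by move=> j; have /imsetP[k _ ->] := aR j; exists k.
  rewrite inE; apply/asboolP.
  suff -> : [ffun i => f [ffun j => a j i]] =
            [ffun i => f [ffun j => col (tau j) i]] :> bvec M.
    by rewrite key; apply: Fm.
  apply/ffunP => i; rewrite !ffunE; congr (f _).
  by apply/ffunP => j; rewrite !ffunE tauE ffunE.
apply: FN => tau; rewrite -key.
have := hf q (mem_head _ _) (fun j => col (tau j)).
rewrite inE => /(_ _)/asboolP; apply=> j.
by apply: imset_f; rewrite inE.
Qed.

Lemma clone_ext (C : fclass) n (f g : boolfun n.+1) :
  (forall x, f x = g x) -> C n f -> C n g.
Proof. by move=> /ffunP ->. Qed.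

Lemma clone_minor_closed (C : fclass) : is_clone C -> minor_closed C.
Proof.
move=> [Cp Cc] n m f tau Cf.
have := Cc n m f (fun j => bproj (tau j)) Cf (fun j => Cp _ _).
apply: clone_ext => x; rewrite !ffunE; congr (f _).
by apply/ffunP => j; rewrite !ffunE.
Qed.

Lemma threshold_minor_closed (R : realType) : minor_closed (threshold R).
Proof.
move=> n m f tau [w [t hf]].
exists (fun k => \sum_(j | tau j == k) w j), t => x; rewrite ffunE hf.
suff -> : \sum_(i < n.+1) w i * ([ffun j => x (tau j)] i)%:R =
          \sum_(k < m.+1) (\sum_(j | tau j == k) w j) * (x k)%:R by [].
rewrite (partition_big tau predT) //=; apply: eq_bigr => k _.
by rewrite mulr_suml; apply: eq_bigr => j /eqP <-; rewrite ffunE.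
Qed.

Lemma fcap_threshold_minor_closed (R : realType) (C : fclass) :
  is_clone C -> minor_closed (fcap C (threshold R)).
Proof.
move=> hC n m f tau [Cf Tf]; split; first exact: clone_minor_closed.
exact: threshold_minor_closed.
Qed.

(** Such an f is a minor of its own minor that identifies all variables. *)
Lemma minor_closed_unary (F : fclass) n (f : boolfun n.+1) m (i : 'I_n.+1) :
  minor_closed F -> (forall tau, F m (minor f tau)) ->
  (forall x, f x = f [ffun=> x i]) -> F n f.
Proof.
move=> Fm Ff hf; have := Fm _ _ _ (fun=> i) (Ff (fun=> ord0)).
set g := minor _ _; suff -> : g = f by [].
by apply/ffunP => x; rewrite !ffunE [RHS]hf; congr (f _).
Qed.

(** * Duality *)

Definition bneg (n : nat) (x : bvec n) : bvec n := [ffun i => ~~ x i].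

Lemma bnegK n : involutive (@bneg n).
Proof. by move=> x; apply/ffunP => i; rewrite !ffunE negbK. Qed.

Definition dual (n : nat) (f : boolfun n) : boolfun n :=
  [ffun x => ~~ f (bneg x)].

Lemma dualK n : involutive (@dual n).
Proof. by move=> f; apply/ffunP => x; rewrite !ffunE negbK bnegK. Qed.

Definition dual_class (C : fclass) : fclass := fun n f => C n (dual f).

Lemma dual_minor n m (f : boolfun n) (tau : 'I_n -> 'I_m) :
  dual (minor f tau) = minor (dual f) tau.
Proof.
apply/ffunP => x; rewrite !ffunE; congr (~~ f _).
by apply/ffunP => i; rewrite !ffunE.
Qed.

Lemma dual_is_clone C : is_clone C -> is_clone (dual_class C).
Proof.
move=> [Cp Cc]; split=> [n i|n m f g Cf Cg].
  by apply: clone_ext (Cp n i) => x; rewrite !ffunE negbK.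
apply: clone_ext (Cc n m _ _ Cf Cg) => x; rewrite !ffunE; congr (~~ f _).
by apply/ffunP => i; rewrite !ffunE negbK.
Qed.

(** There are finitely many points, so the sums exceeding t exceed it by a common gap e > 0, and t +
    e is a non-strict threshold. *)
Lemma threshold_strict (R : realType) n (f : boolfun n.+1) (w : 'I_n.+1 -> R) t :
  (forall x : bvec n.+1, f x <-> t < \sum_(i < n.+1) w i * (x i)%:R) ->
  threshold R f.
Proof.
pose L (x : bvec n.+1) := \sum_(i < n.+1) w i * (x i)%:R.
move=> hf.
have [e e0 he] : exists2 e, 0 < e &
    forall x, x \in enum {: bvec n.+1} -> t < L x -> t + e <= L x.
  elim: (enum _) => [|x s [e e0 IH]]; first by exists 1.
  have [lt_tx|le_xt] := ltP t (L x).
    exists (Num.min e (L x - t)) => [|y].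
      by rewrite lt_min e0 subr_gt0.
    rewrite inE -lerBrDl ge_min => /orP[/eqP ->|ys] lt_ty.
      by rewrite lexx orbT.
    by rewrite lerBrDl IH.
  exists e => // y; rewrite inE => /orP[/eqP ->|]; last exact: IH.
  by rewrite ltNge le_xt.
exists w, (t + e) => x; rewrite hf; split => [|le_tx].
  by apply: he; rewrite mem_enum.
by apply: lt_le_trans le_tx; rewrite ltrDl.
Qed.

(** Complementing the input turns a weighted sum s into [\sum_i w i - s], so the negated condition
    is a strict inequality with bound [\sum_i w i - t]. *)
Lemma threshold_dual (R : realType) n (f : boolfun n.+1) :
  threshold R f -> threshold R (dual f).
Proof.
move=> [w [t hf]].
apply: (@threshold_strict R n _ w (\sum_i w i - t)) => x; rewrite ffunE.
have -> : (\sum_i w i - t < \sum_(i < n.+1) w i * (x i)%:R) =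
          ~~ (t <= \sum_(i < n.+1) w i * (bneg x i)%:R).
  rewrite -ltNge ltrBlDr -ltrBlDl -sumrB.
  congr (_ < _); apply: eq_bigr => i _; rewrite ffunE.
  by case: (x i); rewrite /= !(mulr1, mulr0) ?subrr ?subr0.
by split; apply: contra => /hf.
Qed.

Lemma determined_dual (R : realType) N (C : fclass) :
  determined_by_minors N (fcap C (threshold R)) ->
  determined_by_minors N (fcap (dual_class C) (threshold R)).
Proof.
move=> hC n f hf.
have [|Cf Tf] := hC n (dual f).
  move=> tau; rewrite -dual_minor.
  by have [Cg Tg] := hf tau; split=> //; apply: threshold_dual.
by split=> //; rewrite -[f]dualK; apply: threshold_dual.
Qed.

(** * Integer weights *)

(** The strict sign test is the shape in which the grid forms below arise; over the integers it
    amounts to a bound by 1. *)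
Definition int_threshold (n : nat) (g : bvec n -> bool) : Prop :=
  exists (w : 'I_n -> int) (c : int),
    forall x, g x = (0 < \sum_i w i * (x i)%:Z + c).

Lemma int_threshold_true n : int_threshold (fun _ : bvec n => true).
Proof.
by exists (fun=> 0), 1 => x; rewrite big1 // => i _; rewrite mul0r.
Qed.

(** Adding M * (x j - 1), with M bounding the whole affine form, changes nothing when x j is true
    and makes the form nonpositive otherwise. *)
Lemma int_threshold_and n (g : bvec n -> bool) j :
  int_threshold g -> int_threshold (fun x => x j && g x).
Proof.
case=> w [c hg].
pose M := \sum_i `|w i| + `|c|.
exists (fun i => w i + M * (i == j)%:Z), (c - M) => x.
have -> : \sum_i (w i + M * (i == j)%:Z) * (x i)%:Z =
    \sum_i w i * (x i)%:Z + M * (x j)%:Z.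
  under eq_bigr do rewrite mulrDl.
  rewrite big_split /=; congr (_ + _).
  rewrite (bigD1 j) //= big1 => [|i /negPf ->]; last by rewrite mulr0 mul0r.
  by rewrite eqxx mulr1 addr0.
rewrite hg; case: (x j) => /=.
  by rewrite mulr1 addrACA subrr addr0.
suff le_w : \sum_i w i * (x i)%:Z <= \sum_i `|w i|.
  by apply/esym/negbTE; rewrite mulr0 addr0 -leNgt addrA subr_le0 lerD // ler_norm.
apply: ler_sum => i _; case: (x i); rewrite ?mulr1 ?mulr0 //.
exact: ler_norm.
Qed.

Lemma int_threshold_threshold (R : realType) n (f : boolfun n.+1) :
  int_threshold f -> threshold R f.
Proof.
case=> w [c hf]; exists (fun i => (w i)%:~R), (1 - c%:~R) => x.
have -> : \sum_i (w i)%:~R * (x i)%:R = (\sum_i w i * (x i)%:Z)%:~R :> R.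
  by rewrite rmorph_sum /=; apply: eq_bigr => i _; rewrite rmorphM.
rewrite lerBlDr -intrD -[1]/(1%:~R) ler_int hf.
by rewrite -gtz0_ge1.
Qed.

(** Asummability: equal coordinate totals give equal total weights, while each true point outweighs
    each false point. *)
Lemma not_threshold (R : realType) n (f : boolfun n.+1) (I : finType) (i0 : I)
    (a b : I -> bvec n.+1) :
  (forall i, f (a i)) -> (forall i, ~~ f (b i)) ->
  (forall p, (\sum_i a i p = \sum_i b i p)%N) -> ~ threshold R f.
Proof.
move=> fa fb ab [w [t hf]].
pose L (x : bvec n.+1) := \sum_(i < n.+1) w i * (x i)%:R.
have sumL (c : I -> bvec n.+1) : \sum_i L (c i) = \sum_p w p * (\sum_i c i p)%N%:R.
  rewrite exchange_big /=; apply: eq_bigr => p _.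
  by rewrite natr_sum mulr_sumr.
have gap i : 0 < L (a i) - L (b i).
  rewrite subr_gt0; apply: (@lt_le_trans _ _ t); last exact/hf.
  by rewrite ltNge; apply: contra (fb i) => /hf.
have : \sum_i (L (a i) - L (b i)) = 0.
  rewrite sumrB !sumL; apply/eqP; rewrite subr_eq0; apply/eqP.
  by apply: eq_bigr => p _; rewrite ab.
move=> /psumr_eq0P -/(_ (fun i _ => ltW (gap i)) i0 isT) h.
by have := gap i0; rewrite h ltxx.
Qed.

(** * Clones below L and Lambda *)

Definition pt3 (a b c : bool) : bvec 3 := [ffun i : 'I_3 => nth false [:: a; b; c] i].

(** Collapsing the variables along these blocks reduces an identity between values of f at x, y and
    their combinations to a ternary minor, whence N = 2. *)
Definition blocks3 n (x y : bvec n) (i : 'I_n) : 'I_3 :=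
  if x i then inord 0 else if y i then inord 1 else inord 2.

Lemma minor_blocks3 n (f : boolfun n) (x y : bvec n) a b c :
  minor f (blocks3 x y) (pt3 a b c) =
  f [ffun i => if x i then a else if y i then b else c].
Proof.
rewrite ffunE; congr (f _); apply/ffunP => i; rewrite !ffunE /blocks3.
by case: (x i); case: (y i); rewrite /= inordK.
Qed.

(** The points 00, 11 and the points 01, 10 have the same coordinate sums, and f is true on exactly
    one of the two pairs. *)
Lemma xor_not_threshold (R : realType) (f : boolfun 3) :
  f (pt3 true true false) = f (pt3 false false false) ->
  f (pt3 true false false) != f (pt3 false false false) ->
  f (pt3 false true false) != f (pt3 false false false) ->
  ~ threshold R f.
Proof.
pose same (b : bool) := pt3 b b false; pose diff b := pt3 b (~~ b) false.
have sums (p : 'I_3) : (\sum_b same b p = \sum_b diff b p)%N.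
  by rewrite !big_bool !ffunE; case: p => -[|[|[|]]].
move=> f11 f10 f01; case f00: (f (pt3 false false false)) f11 f10 f01 => f11 f10 f01.
  apply: (@not_threshold R 2 f bool true same diff) => //; case;
    rewrite /same /diff /= ?f11 ?f00 //.
  - by case: (f _) f10.
  - by case: (f _) f01.
apply: (@not_threshold R 2 f bool true diff same) => //; case;
  rewrite /same /diff /= ?f11 ?f00 //.
- by case: (f _) f10.
- by case: (f _) f01.
Qed.

(** Every x is a meet of points with a single false coordinate. Meeting them in one at a time keeps
    the zero sets disjoint, and leaves the conjunction of the variables i with [c i] false, unless f
    is constant. *)
Lemma meet_cloneLambda n (f : boolfun n.+1) :
  (forall x y : bvec n.+1, (forall i, x i || y i) ->
     f [ffun i => x i && y i] = f x && f y) ->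
  cloneLambda f.
Proof.
move=> hf; pose one : bvec n.+1 := [ffun=> true].
pose c (i : 'I_n.+1) := f [ffun k => k != i].
have fE (s : seq 'I_n.+1) x : uniq s ->
    f [ffun k => x k || (k \notin s)] =
    f one && \big[andb/true]_(i <- s) (x i || c i).
  elim: s => [_|i s IH /andP[i_s us]].
    rewrite big_nil andbT; congr (f _).
    by apply/ffunP => k; rewrite !ffunE in_nil orbT.
  rewrite big_cons; case xi: (x i) => /=.
    rewrite -IH //; congr (f _); apply/ffunP => k; rewrite !ffunE in_cons.
    by case: eqP => [->|//]; rewrite xi.
  rewrite andbCA -IH // andbC -hf => [|k]; last first.
    by rewrite !ffunE; case: eqP => [->|]; rewrite ?i_s ?orbT.
  congr (f _); apply/ffunP => k; rewrite !ffunE in_cons.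
  by case: eqP => [->|_]; rewrite ?xi ?andbF ?andbT.
have {}fE x : f x = f one && \big[andb/true]_(i <- enum 'I_n.+1) (x i || c i).
  rewrite -fE ?enum_uniq //; congr (f _).
  by apply/ffunP => k; rewrite ffunE mem_enum orbF.
case f1: (f one) fE => fE; last by left; exists false.
pose s := [seq i <- enum 'I_n.+1 | ~~ c i].
have {}fE x : f x = \big[andb/true]_(i <- s) x i.
  rewrite fE [RHS]big_filter [RHS]big_mkcond /=; apply: eq_bigr => i _.
  by case: (c i); rewrite ?orbT ?orbF.
have [s0|s0] := eqVneq s [::]; last by right; exists s.
by left; exists true => x; rewrite fE s0 big_nil.
Qed.

Lemma cloneLambda_meet n (f : boolfun n.+1) (x y : bvec n.+1) :
  cloneLambda f -> f [ffun i => x i && y i] = f x && f y.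
Proof.
case=> [[b fE]|[s [_ fE]]]; first by rewrite !fE andbb.
by rewrite !fE -big_split /=; apply: eq_bigr => i _; rewrite ffunE.
Qed.

(** Adding unit vectors one at a time keeps supports disjoint, so additivity on disjoint supports
    already gives the affine expansion. *)
Lemma add_cloneL n (f : boolfun n.+1) :
  (forall x y : bvec n.+1, (forall i, ~~ (x i && y i)) ->
     f [ffun i => x i || y i] = f x (+) f y (+) f [ffun=> false]) ->
  forall x, f x = f [ffun=> false] (+)
    \big[addb/false]_(i < n.+1)
      ((f [ffun k => k == i] (+) f [ffun=> false]) && x i).
Proof.
move=> hf; pose o : bvec n.+1 := [ffun=> false].
have fE (s : seq 'I_n.+1) (x : bvec n.+1) : uniq s ->
    f [ffun k => x k && (k \in s)] = f o (+)
      \big[addb/false]_(i <- s) ((f [ffun k => k == i] (+) f o) && x i).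
  elim: s => [_|i s IH /andP[i_s us]].
    rewrite big_nil addbF; congr (f _).
    by apply/ffunP => k; rewrite !ffunE in_nil andbF.
  rewrite big_cons; case xi: (x i) => /=; last first.
    rewrite andbF /= -IH //; congr (f _); apply/ffunP => k; rewrite !ffunE in_cons.
    by case: eqP => [->|//]; rewrite xi.
  rewrite andbT addbCA -IH // [RHS]addbC addbA -hf => [|k]; last first.
    by rewrite !ffunE; case: eqP => [->|]; rewrite ?andbF // (negPf i_s) andbF.
  congr (f _); apply/ffunP => k; rewrite !ffunE in_cons.
  by case: eqP => [->|_]; rewrite ?xi ?orbT ?orbF.
move=> x; rewrite -big_enum /= -fE ?enum_uniq //; congr (f _).
by apply/ffunP => k; rewrite ffunE mem_enum andbT.
Qed.

Lemma cloneL_add n (f : boolfun n.+1) (x y : bvec n.+1) :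
  cloneL f -> (forall i, ~~ (x i && y i)) ->
  f [ffun i => x i || y i] = f x (+) f y (+) f [ffun=> false].
Proof.
case=> c0 [c fE] xy; rewrite !fE.
have -> : \big[addb/false]_i (c i && [ffun i => x i || y i] i) =
    \big[addb/false]_i (c i && x i) (+) \big[addb/false]_i (c i && y i).
  rewrite -big_split /=; apply: eq_bigr => i _; rewrite ffunE.
  by move: (xy i); case: (c i); case: (x i); case: (y i).
have -> : \big[addb/false]_i (c i && [ffun=> false] i) = false.
  by apply: big1 => i _; rewrite ffunE andbF.
by rewrite addbF addbACA addbb addFb addbC.
Qed.

Lemma ternary_cloneL n (f : boolfun n.+1) :
  (forall tau : 'I_n.+1 -> 'I_3, minor f tau (pt3 true true false) =
     minor f tau (pt3 true false false) (+) minor f tau (pt3 false true false)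
     (+) minor f tau (pt3 false false false)) ->
  cloneL f.
Proof.
move=> hf.
exists (f [ffun=> false]), (fun i => f [ffun k => k == i] (+) f [ffun=> false]).
apply: add_cloneL => x y xy; have := hf (blocks3 x y); rewrite !minor_blocks3.
congr (f _ = f _ (+) f _ (+) f _); apply/ffunP => i; rewrite !ffunE;
  by have := xy i; case: (x i); case: (y i).
Qed.

(** The cases are at most one nonzero linear coefficient and at least two. *)
Lemma cloneL_unary_or_xor n (f : boolfun n.+1) :
  cloneL f ->
  (exists i, forall x, f x = f [ffun=> x i]) \/
  (exists i j, [/\ i != j, f [ffun k => k == i] != f [ffun=> false] &
                   f [ffun k => k == j] != f [ffun=> false]]).
Proof.
move=> Lf; have fE := add_cloneL (fun x y => @cloneL_add _ f x y Lf).
pose d i := f [ffun k => k == i] (+) f [ffun=> false].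
have dE i : d i -> f [ffun k => k == i] != f [ffun=> false].
  by rewrite /d; case: (f _); case: (f _).
have [/existsP[i di]|/existsPn d0] := boolP [exists i, d i]; last first.
  have f0 x : f x = f [ffun=> false].
    rewrite fE big1 ?addbF // => i _.
    by have := d0 i; rewrite /d => /negPf ->.
  by left; exists ord0 => x; rewrite [LHS]f0 [RHS]f0.
have [/existsP[j /andP[ij dj]]|/existsPn dN] := boolP [exists j, (i != j) && d j].
  by right; exists i, j; rewrite ij !dE.
left; exists i => x.
have fi y : f y = f [ffun=> false] (+) (d i && y i).
  rewrite fE (bigD1 i) //= big1 ?addbF // => j ji.
  by have := dN j; rewrite eq_sym ji /= /d => /negPf ->.
by rewrite [LHS]fi [RHS]fi ffunE.
Qed.

(** Ternary minors detect linearity. Two essential variables would give a minor that behaves as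
    exclusive or and is not threshold, so f has at most one and is recovered from a minor. *)
Lemma determined_sub_cloneL (R : realType) (C : fclass) :
  is_clone C -> fsub C cloneL -> determined_by_minors 2 (fcap C (threshold R)).
Proof.
move=> hC CL n f hf.
have Fm := fcap_threshold_minor_closed (R := R) hC.
have Lf : cloneL f.
  apply: ternary_cloneL => tau.
  have [/CL/cloneL_add hL _] := hf tau.
  have := hL (pt3 true false false) (pt3 false true false).
  have -> : [ffun i => pt3 true false false i || pt3 false true false i] =
             pt3 true true false.
    by apply/ffunP; case=> -[|[|[|]]] //= ?; rewrite !ffunE.
  have -> : [ffun=> false] = pt3 false false false.
    by apply/ffunP; case=> -[|[|[|]]] //= ?; rewrite !ffunE.
  by apply; case=> -[|[|[|]]] //= ?; rewrite !ffunE.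
have [[i fi]|[i [j [ij fi fj]]]] := cloneL_unary_or_xor Lf.
  exact: (minor_closed_unary Fm hf fi).
pose e k : bvec n.+1 := [ffun l => l == k].
have eij k : ~~ (e i k && e j k).
  by rewrite !ffunE; case: eqP => [->|//]; rewrite (negPf ij).
have f0 : minor f (blocks3 (e i) (e j)) (pt3 false false false) = f [ffun=> false].
  rewrite minor_blocks3; congr (f _); apply/ffunP => k; rewrite !ffunE.
  by case: (k == i); case: (k == j).
have [_ Tf] := hf (blocks3 (e i) (e j)).
exfalso; move: Tf; apply: xor_not_threshold; rewrite f0 minor_blocks3.
- have -> : [ffun k => if e i k then true else if e j k then true else false] =
             [ffun k => e i k || e j k].
    by apply/ffunP => k; rewrite !ffunE; case: (k == i); case: (k == j).
  by rewrite (cloneL_add Lf) //; move: fi fj; rewrite /e; case: (f _); case: (f _); case: (f _).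
- suff -> : [ffun k => if e i k then true else if e j k then false else false] = e i by [].
  by apply/ffunP => k; rewrite !ffunE; case: (k == i); case: (k == j).
- suff -> : [ffun k => if e i k then false else if e j k then true else false] = e j by [].
  apply/ffunP => k; rewrite [LHS]ffunE; have := eij k.
  by case: (e i k); case: (e j k).
Qed.

Lemma clone_and2 (C : fclass) n (f g : boolfun n.+1) m (h : boolfun m.+1) i j :
  is_clone C ->
  (forall x, h x = x i && x j) -> i != j ->
  C m h -> C n f -> C n g -> C n [ffun x => f x && g x].
Proof.
move=> [_ Cc] hE ij Ch Cf Cg.
pose a k := if k == i then f else g.
have := Cc _ _ h a Ch; have aC k : C n (a k) by rewrite /a; case: eqP.
move=> /(_ aC); apply: clone_ext => x.
by rewrite !ffunE hE !ffunE /a eqxx [j == i]eq_sym (negPf ij).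
Qed.

Lemma ternary_cloneLambda n (f : boolfun n.+1) : 
  (forall tau : 'I_n.+1 -> 'I_3, minor f tau (pt3 false false true) =
    minor f tau (pt3 false true true) && minor f tau (pt3 true false true)) ->
  cloneLambda f.
Proof.
move=> hf; apply: meet_cloneLambda => x y xy.
(* By [xy] the zero sets are disjoint: x is false exactly on block 0 and y exactly on block 1. *)
have := hf (blocks3 (bneg x) (bneg y)); rewrite !minor_blocks3.
congr (f _ = f _ && f _); apply/ffunP => i; rewrite !ffunE;
  by have := xy i; case: (x i); case: (y i).
Qed.

(** Ternary minors force f to be constant or a conjunction. A conjunction is always threshold; one
    with two distinct variables has binary conjunction as a minor, and this puts f in C. *)
Lemma determined_sub_cloneLambda (R : realType) (C : fclass) :
  is_clone C -> fsub C cloneLambda -> determined_by_minors 2 (fcap C (threshold R)).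
Proof.
move=> hC CL n f hf.
have Fm := fcap_threshold_minor_closed (R := R) hC.
have : cloneLambda f.
  apply: ternary_cloneLambda => tau.
  have [/CL/(cloneLambda_meet (pt3 false true true) (pt3 true false true)) <- _] := hf tau.
  congr (minor f tau _).
  by apply/ffunP; case=> -[|[|[|]]] //= ?; rewrite !ffunE.
case=> [[b fb]|[s [s0 fs]]].
  by apply: (minor_closed_unary (i := ord0) Fm hf) => x; rewrite !fb.
have [i si] : exists i, i \in s by case: s s0 {fs} => // i s _; exists i; rewrite mem_head.
have [/allP all_i|/allPn[j sj ij]] := boolP (all (pred1 i) s).
  apply: (minor_closed_unary (i := i) Fm hf) => x; rewrite !fs !big_seq.
  by apply: eq_bigr => k /all_i /eqP ->; rewrite ffunE.
split; last first.
  apply: int_threshold_threshold.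
  suff [w [c h]] : int_threshold (fun x : bvec n.+1 => \big[andb/true]_(i <- s) x i).
    by exists w, c => x; rewrite fs h.
  elim: s {s0 fs si sj} => [|k s IH].
    by have [w [c h]] := int_threshold_true n.+1; exists w, c => x; rewrite big_nil; apply: h.
  by have [w [c h]] := int_threshold_and k IH; exists w, c => x; rewrite big_cons h.
(* Both i and some j other than i occur in s, so separating i from all the rest leaves the
   conjunction of two variables. *)
pose tau k : 'I_3 := if k == i then inord 0 else inord 1.
have [Cg _] := hf tau.
have gE x : minor f tau x = x (inord 0) && x (inord 1).
  rewrite ffunE fs; apply/idP/idP.
    rewrite big_all => /allP h.
    have := h _ si; have := h _ sj; rewrite !ffunE /tau eqxx.
    by move: ij; rewrite /= eq_sym => /negPf -> -> ->.
  move=> /andP[x0 x1]; rewrite big_all; apply/allP => k _.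
  by rewrite ffunE /tau; case: eqP.
have ne01 : inord 0 != inord 1 :> 'I_3 by rewrite -val_eqE /= !inordK.
have C_and := clone_and2 hC gE ne01.
have : s != [::] -> C n [ffun x : bvec n.+1 => \big[andb/true]_(i <- s) x i].
  elim: (s) => [//|k [|l r] IH] _.
    by apply: clone_ext (hC.1 n k) => x; rewrite !ffunE big_seq1.
  apply: clone_ext (C_and _ _ _ Cg (hC.1 n k) (IH isT)) => x.
  by rewrite !ffunE [RHS]big_cons.
by move=> /(_ s0) Cs; apply: clone_ext Cs => x; rewrite ffunE fs.
Qed.

(** * Clones not below L, V, Lambda *)

(** Curried ternary functions, so that identities between terms are settled by evaluating eight
    cases. *)
Definition op3 := bool -> bool -> bool -> bool.

Record op3_clone (P : op3 -> Prop) : Prop := Op3Clone {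
  op3_ext : forall g h : op3, (forall a b c, g a b c = h a b c) -> P g -> P h;
  op3_fst : P (fun a _ _ => a);
  op3_snd : P (fun _ b _ => b);
  op3_trd : P (fun _ _ c => c);
  op3_comp : forall g h k l : op3, P g -> P h -> P k -> P l ->
    P (fun a b c => g (h a b c) (k a b c) (l a b c))
}.

Definition and3 : op3 := fun a b _ => a && b.
Definition or3 : op3 := fun a b _ => a || b.
Definition maj3 : op3 := fun a b c => (a && b) || (a && c) || (b && c).
Definition and_or3 : op3 := fun a b c => a && (b || c).

Section Op3Clone.
Variables (P : op3 -> Prop) (hP : op3_clone P).

Let P1 := op3_fst hP.
Let P2 := op3_snd hP.
Let P3 := op3_trd hP.
Let Pc := op3_comp hP.

(** With its first argument true, g does not preserve the meet of 10 and 01. Working below [a], by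
    conjoining with it, each possible table of this restriction generates disjunction. *)
Lemma op3_clone_and_or g : P and3 -> P g ->
  g true false false != g true true false && g true false true ->
  P and_or3.
Proof.
move=> Pa Pg; case g100: (g true false false) => gN.
  have Pabc := Pc Pa (Pc Pa P1 P2 P3) P3 P3.
  wlog g110 : g Pg g100 gN / g true true false = false.
    move=> H; case g110: (g true true false) (gN) => /= gN'; last exact: H gN g110.
    have Pg' := Pc Pg P1 P3 P2.
    by apply: (H _ Pg') => /=; rewrite ?g100 ?g110; case: (g _ _ _) gN'.
  have Pk := Pc Pa P1 (Pc Pg P1 (Pc Pa P1 P2 P2) Pabc) P3.
  case g111: (g true true true).
    (* Below [a], [Pk] is the implication from b to c, and (b -> c) -> c is b || c. *)
    apply: op3_ext hP _ _ _ (Pc Pk P1 (Pc Pk P1 P2 P3) P3).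
    by do 3 case; rewrite /and3 /and_or3 /= ?g100 ?g110 ?g111 //= ?g100 ?g110 ?g111.
  have Pr := Pc Pa P1 (Pc Pg P1 (Pc Pa P1 P2 P2) (Pc Pa P1 P2 P2)) P3.
  (* Here [Pr] is a && ~~ b, and De Morgan gives the disjunction. *)
  apply: op3_ext hP _ _ _ (Pc Pr P1 (Pc Pr (Pc Pr P1 P2 P2) P3 P3) P3).
  by do 3 case; rewrite /and3 /and_or3 /= ?g100 ?g110 ?g111 //= ?g100 ?g110 ?g111.
have [g110 g101] : g true true false = true /\ g true false true = true.
  by move: gN; case: (g _ _ _) => //; case: (g _ _ _).
have Pk := Pc Pa P1 (Pc Pg P1 (Pc Pa P1 P2 P2) (Pc Pa P1 P3 P3)) P3.
case g111: (g true true true).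
  apply: op3_ext hP _ _ _ Pk.
  by do 3 case; rewrite /and3 /and_or3 /= ?g100 ?g110 ?g101 ?g111.
(* Below [a], [Pk] is exclusive or, and b (+) c (+) (b && c) is b || c. *)
apply: op3_ext hP _ _ _ (Pc Pk P1 P2 (Pc Pk P1 P3 (Pc Pa P2 P3 P3))).
by do 3 case; rewrite /and3 /and_or3 /= ?g100 ?g110 ?g101 ?g111 //= ?g100 ?g110 ?g101 ?g111.
Qed.

(** An odd number of the four values are true. In each of the eight tables, h or one of h(a,
    h(a,b)), h(h(a,b), b), h(h(a,b), h(a,b)) is conjunction or disjunction. *)
Lemma op3_clone_binary (h : bool -> bool -> bool) : P (fun a b _ => h a b) ->
  h true true != h true false (+) h false true (+) h false false ->
  P and3 \/ P or3.
Proof.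
move=> Ph hN; have Phh k l : P k -> P l -> P (fun a b c => h (k a b c) (l a b c)).
  by move=> Pk Pl; apply: (Pc Ph Pk Pl P3).
have Phab := Ph.
have Pand k : P k -> (forall a b c, k a b c = a && b) -> P and3 \/ P or3.
  by move=> Pk kE; left; apply: op3_ext hP _ _ kE Pk.
have Por k : P k -> (forall a b c, k a b c = a || b) -> P and3 \/ P or3.
  by move=> Pk kE; right; apply: op3_ext hP _ _ kE Pk.
case h11: (h true true) hN; case h10: (h true false);
  case h01: (h false true); case h00: (h false false) => // _.
- by apply: Por Ph _; case; case=> c; rewrite ?(h11, h10, h01, h00).
- by apply: Por (Phh _ _ P1 Ph) _; case; case=> c; rewrite ?(h11, h10, h01, h00).
- by apply: Por (Phh _ _ Ph P2) _; case; case=> c; rewrite ?(h11, h10, h01, h00).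
- by apply: Pand Ph _; case; case=> c; rewrite ?(h11, h10, h01, h00).
- by apply: Pand (Phh _ _ Ph Ph) _; case; case=> c; rewrite ?(h11, h10, h01, h00).
- by apply: Pand (Phh _ _ P1 Ph) _; case; case=> c; rewrite ?(h11, h10, h01, h00).
- by apply: Pand (Phh _ _ Ph P2) _; case; case=> c; rewrite ?(h11, h10, h01, h00).
- by apply: Por (Phh _ _ Ph Ph) _; case; case=> c; rewrite ?(h11, h10, h01, h00).
Qed.

(** Without conjunction and disjunction all binary members are linear. Applied to identifications of
    g, this leaves few tables, and majority is a short term in each. *)
Lemma op3_clone_nonlinear g : P g ->
  g true true false != g true false false (+) g false true false (+) g false false false ->
  [\/ P and3, P or3 | P maj3].
Proof.
move=> Pg gN.
have [Pa|Na] := pselect (P and3); first by constructor 1.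
have [Po|No] := pselect (P or3); first by constructor 2.
constructor 3.
have lin h : P (fun a b _ => h a b) ->
    h true true = h true false (+) h false true (+) h false false.
  by move=> Ph; apply/eqP; apply: contrapT => /negP /(op3_clone_binary Ph) [].
have e1 := lin _ (Pc Pg P1 P2 P2).
have e2 := lin _ (Pc Pg P1 P2 P1).
have e3 := lin _ (Pc Pg P1 P1 P2).
(* The diagonal of g applied to g: the negation of g when that diagonal is negation. *)
have Pg' := Pc (Pc Pg P1 P1 P1) Pg P1 P1.
have e4 := lin _ (Pc Pg P1 P2 (Pc Pg P1 P1 P1)).
move: gN e1 e2 e3 e4.
case g000: (g false false false); case g100: (g true false false);
case g010: (g false true false); case g001: (g false false true);
case g110: (g true true false); case g101: (g true false true);
case g011: (g false true true); case g111: (g true true true) => //=;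
rewrite ?(g000, g001, g010, g011, g100, g101, g110, g111) //= => _ _ _ _ _.
all: let close Pk := (by apply: op3_ext hP _ _ _ Pk; do 3 case;
       rewrite ?(g000, g001, g010, g011, g100, g101, g110, g111)) in
  first [ close Pg | close Pg'
        | close (Pc Pg P1 P2 Pg) | close (Pc Pg P1 Pg P3) | close (Pc Pg Pg P2 P3)
        | close (Pc Pg' P1 P2 Pg') | close (Pc Pg' P1 Pg' P3) | close (Pc Pg' Pg' P2 P3)].
Qed.
End Op3Clone.

Definition has_op3 (C : fclass) (g : op3) : Prop :=
  C 2 [ffun x : bvec 3 => g (x (inord 0)) (x (inord 1)) (x (inord 2))].

Lemma has_op3_app (C : fclass) g n (f1 f2 f3 : boolfun n.+1) : is_clone C ->
  has_op3 C g -> C n f1 -> C n f2 -> C n f3 ->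
  C n [ffun x => g (f1 x) (f2 x) (f3 x)].
Proof.
move=> hC Cg C1 C2 C3.
pose a (i : 'I_3) := if i == inord 0 then f1 else if i == inord 1 then f2 else f3.
apply: clone_ext (hC.2 _ _ _ a Cg _) => [x|i]; last first.
  by rewrite /a; case: eqP => // _; case: eqP.
by rewrite !ffunE /a -!val_eqE /= !inordK.
Qed.

Lemma has_op3_clone C : is_clone C -> op3_clone (has_op3 C).
Proof.
move=> hC; split.
- by move=> g h gh; apply: clone_ext => x; rewrite !ffunE gh.
- by apply: clone_ext (hC.1 2 (inord 0)) => x; rewrite !ffunE.
- by apply: clone_ext (hC.1 2 (inord 1)) => x; rewrite !ffunE.
- by apply: clone_ext (hC.1 2 (inord 2)) => x; rewrite !ffunE.
move=> g h k l Cg Ch Ck Cl.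
by apply: clone_ext (has_op3_app hC Cg Ch Ck Cl) => x; rewrite !ffunE.
Qed.

Definition op3_dual (g : op3) : op3 := fun a b c => ~~ g (~~ a) (~~ b) (~~ c).

Lemma has_op3_dual C g : has_op3 (dual_class C) g <-> has_op3 C (op3_dual g).
Proof.
by split=> h; rewrite /has_op3 /dual_class in h *; apply: clone_ext h => x; rewrite !ffunE.
Qed.

Lemma has_op3_pt3 (C : fclass) (f : boolfun 3) :
  C 2 f -> has_op3 C (fun a b c => f (pt3 a b c)).
Proof.
move=> Cf; apply: clone_ext Cf => x; rewrite ffunE; congr (f _).
apply/ffunP => i; rewrite ffunE.
by case: i => -[|[|[|]]] //= ilt; congr (x _); apply: val_inj; rewrite /= inordK.
Qed.

Lemma cloneLambda_dual n (f : boolfun n.+1) : cloneLambda (dual f) <-> cloneV f.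
Proof.
split=> -[[b fb]|[s [s0 fs]]].
- by left; exists (~~ b) => x; rewrite -[f]dualK ffunE fb.
- right; exists s; split=> // x; rewrite -[f]dualK ffunE fs.
  rewrite (big_morph negb negb_and (erefl (~~ true))).
  by apply: eq_bigr => i _; rewrite ffunE negbK.
- by left; exists (~~ b) => x; rewrite ffunE fb.
right; exists s; split=> // x; rewrite ffunE fs.
rewrite (big_morph negb negb_or (erefl (~~ false))).
by apply: eq_bigr => i _; rewrite ffunE negbK.
Qed.

Lemma sub_cloneV C : fsub C cloneV <-> fsub (dual_class C) cloneLambda.
Proof.
split=> h n f Cf; first by rewrite -[f]dualK cloneLambda_dual; apply: h.
by rewrite -cloneLambda_dual; apply: h; rewrite /dual_class dualK.
Qed.

Lemma has_and_or3 C :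
  is_clone C -> has_op3 C and3 -> ~ fsub C cloneLambda -> has_op3 C and_or3.
Proof.
move=> hC Ca; apply: contra_notP => Nao n f Cf; apply: ternary_cloneLambda => tau.
have hP := has_op3_clone hC.
have Cg := has_op3_pt3 (clone_minor_closed hC tau Cf).
(* The rotation puts first the coordinate that is true at all three test points. *)
have Cg' := op3_comp hP Cg (op3_snd hP) (op3_trd hP) (op3_fst hP).
apply/eqP; apply: contrapT => /negP fN; apply: Nao.
by apply: (op3_clone_and_or hP Ca Cg'); rewrite andbC.
Qed.

(** Nonlinearity yields conjunction, disjunction or majority. Not being below Lambda upgrades
    conjunction, and not being below V upgrades disjunction after dualizing. *)
Lemma post_trichotomy C : is_clone C ->
  ~ fsub C cloneL -> ~ fsub C cloneV -> ~ fsub C cloneLambda ->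
  [\/ has_op3 C maj3, has_op3 C and_or3 | has_op3 (dual_class C) and_or3].
Proof.
move=> hC NL NV NLambda; have hP := has_op3_clone hC.
have [] : [\/ has_op3 C and3, has_op3 C or3 | has_op3 C maj3].
- apply: contra_notP NL => N n f Cf; apply: ternary_cloneL => tau.
  have Cg := has_op3_pt3 (clone_minor_closed hC tau Cf).
  apply/eqP; apply: contrapT => /negP fN; apply: N.
  exact: (op3_clone_nonlinear hP Cg).
- by move=> Ca; constructor 2; apply: has_and_or3.
- move=> Co; constructor 3; apply: has_and_or3 => //.
  + exact: dual_is_clone.
  + rewrite has_op3_dual; apply: op3_ext hP _ _ _ Co => a b c.
    by rewrite /op3_dual /and3 negb_and !negbK.
  + by rewrite -sub_cloneV.
by constructor 1.
Qed.

(** * Lexicographic combinations of linear forms *)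

Section Forms.
Variable X : finType.
Implicit Types (z : {ffun X -> bool}) (w : X -> int).

(** With values 1 and -1, complementing a set negates every form. *)
Definition sgb (b : bool) : int := if b then 1 else -1.

Definition form w z : int := \sum_p w p * sgb (z p).

Definition compl z : {ffun X -> bool} := [ffun p => ~~ z p].

Lemma form_compl w z : form w (compl z) = - form w z.
Proof.
by rewrite -sumrN; apply: eq_bigr => p _; rewrite ffunE -mulrN; case: (z p).
Qed.

Lemma form_combine (a : int) w1 w2 z :
  form (fun p => a * w1 p + w2 p) z = a * form w1 z + form w2 z.
Proof.
by rewrite mulr_sumr -big_split; apply: eq_bigr => p _; rewrite mulrDl mulrA.
Qed.

Lemma form_delta q z : form (fun p => (p == q)%:Z) z = sgb (z q).
Proof.
rewrite /form (bigD1 q) //= eqxx mul1r big1 ?addr0 // => p /negPf ->.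
by rewrite mul0r.
Qed.

(** Scale the first form by an M exceeding all absolute values of the second; a nonzero integer
    value of the first then decides the sign. *)
Lemma lex_form w1 w2 : exists w, forall z,
  (0 < form w z) = (0 < form w1 z) || (form w1 z == 0) && (0 < form w2 z).
Proof.
pose M := 1 + \sum_p `|w2 p|.
exists (fun p => M * w1 p + w2 p) => z; rewrite form_combine.
have : `|form w2 z| < M.
  rewrite /M addrC ltzD1; apply: le_trans (ler_norm_sum _ _ _) _.
  by apply: ler_sum => p _; rewrite normrM; case: (z p); rewrite ?normrN ?normr1 mulr1.
move: (form w1 z) (form w2 z) M => a b M bM.
by apply/idP/idP; nia.
Qed.

Lemma lex_form_eq0 w1 w2 w z : (forall z,
    (0 < form w z) = (0 < form w1 z) || (form w1 z == 0) && (0 < form w2 z)) ->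
  (form w z == 0) = (form w1 z == 0) && (form w2 z == 0).
Proof.
move=> h; have := h z; have := h (compl z); rewrite !form_compl.
by move: (form w z) (form w1 z) (form w2 z); lia.
Qed.

Lemma lex_forms (ws : seq (X -> int)) : exists w, forall z,
  (form w z == 0) = all (fun w' => form w' z == 0) ws.
Proof.
elim: ws => [|w' ws [w IH]].
  by exists (fun=> 0) => z; rewrite /form big1 // => p _; rewrite mul0r.
have [w'' h] := lex_form w' w.
by exists w'' => z; rewrite (lex_form_eq0 _ h) IH.
Qed.

End Forms.

(** * The grid function *)

Section Grid.
Variable k : nat.
(** K is at least 3, so that the weight K * (K - 2) of the extra variable is positive. *)
Notation K := k.+3.

Definition grid : finType := option ('I_K * 'I_K).
Implicit Type z : {ffun grid -> bool}.

Definition grow (i : 'I_K) : {ffun grid -> bool} :=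
  [ffun p => if p is Some (a, b) then a == i else true].
Definition gcol (j : 'I_K) : {ffun grid -> bool} :=
  [ffun p => if p is Some (a, b) then b == j else true].

(* With the extra variable true, this form vanishes on the sets with exactly K
   grid points. *)
Definition gsize (p : grid) : int := if p is None then (K * k.+1)%N%:Z else 1.

(* These forms all vanish exactly when membership of (a, b) is the sum of a
   function of a and a function of b. *)
Definition gmixed (a b : 'I_K) (p : grid) : int :=
  ((p == Some (a, b))%:Z + (p == Some (ord0, ord0))%:Z)
  - ((p == Some (a, ord0))%:Z + (p == Some (ord0, b))%:Z).

(* This form is 1 on all rows but the i-th one and -1 on all columns. *)
Definition gsplit (i : 'I_K) (p : grid) : int :=
  if p is Some (a, b) then - (a == i)%:Z else - k.+2%:Z.

Lemma big_grid (F : grid -> int) : \sum_p F p = F None + \sum_a \sum_b F (Some (a, b)).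
Proof.
rewrite (bigD1 None) //=; congr (_ + _).
rewrite pair_big /= (reindex_omap Some id) => [|[]] //=.
by apply: eq_big => [p|[a b]] //; rewrite eqxx.
Qed.

Lemma form_gmixed a b z : form (gmixed a b) z =
  sgb (z (Some (a, b))) + sgb (z (Some (ord0, ord0)))
  - (sgb (z (Some (a, ord0))) + sgb (z (Some (ord0, b)))).
Proof.
rewrite -!form_delta -!big_split /= -sumrB; apply: eq_bigr => p _.
by rewrite /gmixed mulrBl !mulrDl.
Qed.

Lemma form_gsize z : z None -> form gsize z =
  (K * k.+1)%N%:Z + 2 * (\sum_a \sum_b z (Some (a, b)))%N%:Z - (K * K)%N%:Z.
Proof.
move=> z0; rewrite /form big_grid /= z0 mulr1 -addrA; congr (_ + _).
transitivity (\sum_(a < K) \sum_(b < K) (2 * (z (Some (a, b)))%:Z - 1)).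
  by apply: eq_bigr => a _; apply: eq_bigr => b _; rewrite mul1r; case: (z _).
have sumB (F : 'I_K -> int) : \sum_(b < K) (2 * F b - 1) = 2 * (\sum_b F b) - K%:Z.
  by rewrite sumrB -mulr_sumr sumr_const card_ord (natz K).
rewrite (eq_bigr _ (fun a _ => sumB (fun b => (z (Some (a, b)))%:Z))).
rewrite sumrB -mulr_sumr sumr_const card_ord.
congr (2 * _ - _); last by rewrite -mulr_natr (natz K).
rewrite -!natz natr_sum; apply: eq_bigr => a _.
by rewrite natr_sum; apply: eq_bigr => b _; rewrite natz.
Qed.

Lemma sum_sum_row (r : 'I_K -> bool) :
  (\sum_(a < K) \sum_(b < K) r a = K * #|r|)%N.
Proof.
under eq_bigr do rewrite sum_nat_const card_ord.
by rewrite -big_distrr /= -sum1_card [in RHS]big_mkcond.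
Qed.

(** Vanishing mixed differences make the signs a sum of a row function and a column function. As
    only two values occur, one of these is constant, and the size K leaves a single line. *)
Lemma tie_grid z : z None -> form gsize z = 0 ->
  (forall a b, form (gmixed a b) z = 0) ->
  (exists i, z = grow i) \/ (exists j, z = gcol j).
Proof.
move=> z0; rewrite form_gsize // => zK zD.
have {}zK : (\sum_a \sum_b z (Some (a, b)))%N = K by lia.
have zE a b : sgb (z (Some (a, b))) + sgb (z (Some (ord0, ord0))) =
    sgb (z (Some (a, ord0))) + sgb (z (Some (ord0, b))).
  by apply/eqP; rewrite -subr_eq0 -form_gmixed zD.
have one (r : 'I_K -> bool) : (K * #|r| = K)%N -> exists i, forall a, r a = (a == i).
  move=> /eqP; rewrite -[X in _ == X]muln1 eqn_pmul2l // => /card1P[i ri].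
  by exists i => a; have := ri a.
have [/forallP col0|/forallPn[a0 a0N]] :=
    boolP [forall a, z (Some (a, ord0)) == z (Some (ord0, ord0))].
  right; have {}zE a b : z (Some (a, b)) = z (Some (ord0, b)).
    have := zE a b; rewrite (eqP (col0 a)) addrC => /addrI.
    by case: (z _); case: (z _).
  have [|j zj] := one (fun b => z (Some (ord0, b))).
    rewrite -[RHS]zK exchange_big /= -sum_sum_row.
    by apply: eq_bigr => b _; apply: eq_bigr => a _; rewrite [in RHS]zE.
  by exists j; apply/ffunP => -[[a b]|]; rewrite ffunE ?z0 // zE -zj.
left.
(* Rows 0 and a0 differ by the same nonzero amount in every column, which fixes both signs there. *)
have row0 b : z (Some (ord0, b)) = z (Some (ord0, ord0)).
  move: a0N (zE a0 b).
  by case: (z (Some (a0, ord0))); case: (z (Some (a0, b)));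
    case: (z (Some (ord0, ord0))); case: (z (Some (ord0, b))).
have {}zE a b : z (Some (a, b)) = z (Some (a, ord0)).
  have := zE a b; rewrite row0 => /addIr.
  by case: (z _); case: (z _).
have [|i zi] := one (fun a => z (Some (a, ord0))).
  rewrite -[RHS]zK -sum_sum_row.
  by apply: eq_bigr => a _; apply: eq_bigr => b _; rewrite [in RHS]zE.
by exists i; apply/ffunP => -[[a b]|]; rewrite ffunE ?z0 // zE -zi.
Qed.

Definition giscol z := [exists j, (z == gcol j) || (z == compl (gcol j))].

(* Breaking ties through [z None (+) giscol z] makes self-duality immediate. *)
Definition gfun (w : grid -> int) z :=
  if form w z == 0 then z None (+) giscol z else 0 < form w z.

Lemma complK (X : finType) : involutive (@compl X).
Proof. by move=> z; apply/ffunP => p; rewrite !ffunE negbK. Qed.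

Lemma giscol_compl z : giscol (compl z) = giscol z.
Proof.
apply: eq_existsb => j.
by rewrite (inv_eq (@complK _)) (inj_eq (inv_inj (@complK _))) orbC.
Qed.

Lemma gfun_compl w z : gfun w (compl z) = ~~ gfun w z.
Proof.
rewrite /gfun form_compl oppr_eq0 oppr_gt0 giscol_compl ffunE.
case: eqP => [_|/eqP w0]; first by rewrite addNb.
by rewrite -leNgt le_eqVlt (negPf w0).
Qed.

Lemma form_gsize_line z : z None -> (\sum_a \sum_b z (Some (a, b)) = K)%N ->
  form gsize z = 0.
Proof. by move=> z0 zK; rewrite form_gsize // zK; lia. Qed.

Lemma sum_line (i : 'I_K) : (\sum_(a < K) \sum_(b < K) (a == i) = K)%N.
Proof. by rewrite (sum_sum_row (pred1 i)) card1 muln1. Qed.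

Lemma form_gsize_grow i : form gsize (grow i) = 0.
Proof.
apply: form_gsize_line; first by rewrite ffunE.
by rewrite -[RHS](sum_line i); do 2 apply: eq_bigr => ? _; rewrite ffunE.
Qed.

Lemma form_gsize_gcol j : form gsize (gcol j) = 0.
Proof.
apply: form_gsize_line; first by rewrite ffunE.
rewrite exchange_big -[RHS](sum_line j).
by do 2 apply: eq_bigr => ? _; rewrite ffunE.
Qed.

(** Compare by size first, then by all mixed differences lexicographically; a tie means that all
    these forms vanish. *)
Lemma grid_weights : exists w : grid -> int, [/\
  forall z, 0 < form gsize z -> 0 < form w z,
  forall z, z None -> form w z = 0 -> (exists i, z = grow i) \/ (exists j, z = gcol j),
  forall i, form w (grow i) = 0 & forall j, form w (gcol j) = 0].
Proof.
have [w1 w1E] := lex_forms [seq gmixed p.1 p.2 | p <- enum {: 'I_K * 'I_K}].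
have [w wE] := lex_form gsize w1.
have w0 z := lex_form_eq0 z wE.
exists w; split=> [z|z z0|i|j].
- by rewrite wE => ->.
- move/eqP; rewrite w0 w1E all_map => /andP[/eqP gz /allP mz].
  apply: tie_grid => // a b.
  by apply/eqP; apply: (mz (a, b)); rewrite mem_enum.
- apply/eqP; rewrite w0 w1E form_gsize_grow eqxx all_map; apply/allP => -[a b] _ /=.
  by rewrite form_gmixed !ffunE subrr.
- apply/eqP; rewrite w0 w1E form_gsize_gcol eqxx all_map; apply/allP => -[a b] _ /=.
  by rewrite form_gmixed !ffunE [X in X - _]addrC subrr.
Qed.

Lemma form_gsize_lt z z' : (forall p, z p -> z' p) -> z != z' ->
  form gsize z < form gsize z'.
Proof.
move=> le_zz' neq_zz'.
have gsize_gt0 p : 0 < gsize p by case: p.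
have /existsP[p0 p0P] : [exists p, z p != z' p].
  apply: contraNT neq_zz' => /existsPn h; apply/eqP/ffunP => p.
  by apply/eqP; rewrite -[_ == _]negbK h.
have le_p p : gsize p * sgb (z p) <= gsize p * sgb (z' p).
  rewrite ler_pM2l //; move: (le_zz' p).
  by case: (z p) => [->|_] //; case: (z' p).
rewrite /form (bigD1 p0) //= [X in _ < X](bigD1 p0) //=.
apply: ltr_leD; last exact: ler_sum.
rewrite ltr_pM2l //; move: (le_zz' p0) p0P.
by case: (z p0) => [->|_] //; case: (z' p0).
Qed.

Section GridFunction.
Variable w : grid -> int.
Hypothesis w_pos : forall z, 0 < form gsize z -> 0 < form w z.
Hypothesis w_tie : forall z, z None -> form w z = 0 ->
  (exists i, z = grow i) \/ (exists j, z = gcol j).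
Hypothesis w_grow : forall i, form w (grow i) = 0.
Hypothesis w_gcol : forall j, form w (gcol j) = 0.

(** Enlarging z strictly increases its size form, so either z' is positive or z is negative; the tie
    rule cannot break monotonicity. *)
Lemma gfun_mono z z' : (forall p, z p -> z' p) -> gfun w z -> gfun w z'.
Proof.
move=> le_zz'; have [->//|neq_zz'] := eqVneq z z'.
have lt_zz' := form_gsize_lt le_zz' neq_zz'.
have [lt0z|] := ltP 0 (form gsize z').
  by move=> _; have := w_pos lt0z; rewrite /gfun; case: eqP => [->|].
move=> /(lt_le_trans lt_zz'); rewrite -oppr_gt0 -form_compl => /w_pos.
rewrite form_compl oppr_gt0 /gfun => wz.
by rewrite lt_eqF // ltNge ltW.
Qed.

Lemma giscol_grow i : giscol (grow i) = false.
Proof.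
apply/existsP => -[j /orP[]/eqP/ffunP]; last by move=> /(_ None); rewrite !ffunE.
move=> E; pose l : 'I_K := if j == ord0 then ord_max else ord0.
have lj : (l == j) = false.
  by rewrite /l; have [->|/negPf jN] // := eqVneq j ord0; rewrite eq_sym.
by have := E (Some (i, l)); rewrite !ffunE eqxx lj.
Qed.

Lemma giscol_gcol j : giscol (gcol j).
Proof. by apply/existsP; exists j; rewrite eqxx. Qed.

Lemma gfun_grow i : gfun w (grow i).
Proof. by rewrite /gfun w_grow eqxx ffunE giscol_grow. Qed.

Lemma gfun_gcol j : ~~ gfun w (gcol j).
Proof. by rewrite /gfun w_gcol eqxx ffunE giscol_gcol. Qed.

Lemma form_gsplit i z : z None ->
  form (gsplit i) z = - k.+2%:Z - \sum_b sgb (z (Some (i, b))).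
Proof.
move=> z0; rewrite /form big_grid /= z0 mulr1; congr (_ + _).
rewrite (bigD1 i) //= [X in _ + X]big1 => [|a /negPf ai].
  by rewrite addr0 -sumrN; apply: eq_bigr => b _; rewrite eqxx mulN1r.
by rewrite big1 // => b _; rewrite ai mul0r.
Qed.

(** Another row misses row i, giving -(K - 1) + K; a column meets it once, giving -(K - 1) + (K -
    2). *)
Lemma form_gsplit_tie i z : z None -> form w z = 0 -> z != grow i ->
  form (gsplit i) z = if giscol z then -1 else 1.
Proof.
move=> z0 /(w_tie z0)[] [l ->] zi.
  rewrite giscol_grow form_gsplit ?ffunE //.
  have il : (i == l) = false by apply: contraNF zi => /eqP ->.
  under eq_bigr do rewrite ffunE il.
  by rewrite sumr_const card_ord /sgb mulNrn natz; lia.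
rewrite giscol_gcol form_gsplit ?ffunE // (bigD1 l) //= ffunE eqxx.
rewrite (eq_bigr (fun=> -1)) => [|b /negPf bl]; last by rewrite ffunE bl.
by rewrite sumr_const cardC1 card_ord /sgb mulNrn (natz k.+2); lia.
Qed.

Lemma gfun_split i z : z != grow i -> compl z != grow i ->
  gfun w z = (0 < form w z) || (form w z == 0) && (0 < form (gsplit i) z).
Proof.
move=> zi czi; rewrite /gfun; case: eqP => [wz|]; last by rewrite orbF.
rewrite wz ltxx /=; case z0: (z None).
  by rewrite (form_gsplit_tie z0 wz zi); case: (giscol z).
have cz0 : compl z None by rewrite ffunE z0.
have := form_gsplit_tie cz0 _ czi; rewrite form_compl wz oppr0 => /(_ erefl).
rewrite form_compl giscol_compl; case: (giscol z); lia.
Qed.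

(** The minor evaluates [gfun] at no more than 2 ^ n sets, so some row i is never met, nor is its
    complement. There [gsplit i] breaks the ties linearly. *)
Lemma gfun_minor n (tau : grid -> 'I_n) : (2 ^ n < K)%N ->
  int_threshold (fun x : bvec n => gfun w [ffun p => x (tau p)]).
Proof.
move=> nK; pose z (x : bvec n) : {ffun grid -> bool} := [ffun p => x (tau p)].
have [i zi] : exists i, forall x, z x != grow i.
  have [/existsP[i /forallP zi]|/existsPn h] := boolP [exists i, [forall x, z x != grow i]].
    by exists i.
  have : (#|[set grow i | i : 'I_K]| <= #|[set z x | x : bvec n]|)%N.
    apply: subset_leq_card; apply/subsetP => _ /imsetP[i _ ->].
    have /forallPn[x] := h i; rewrite negbK => /eqP <-.
    exact: imset_f.
  rewrite card_imset => [|i j /ffunP/(_ (Some (i, ord0)))]; last first.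
    by rewrite !ffunE eqxx => /esym/eqP.
  rewrite card_ord leqNgt (leq_ltn_trans (leq_imset_card _ _)) //.
  by rewrite card_ffun card_bool card_ord.
have [w' w'E] := lex_form w (gsplit i).
pose v j := \sum_(p | tau p == j) w' p.
(* These come from [sgb b] = 2 b - 1. *)
exists (fun j => 2 * v j), (- \sum_j v j) => x.
rewrite (gfun_split (zi x)); last first.
  apply: contra (zi (bneg x)) => /eqP <-; apply/eqP/ffunP => p.
  by rewrite !ffunE.
rewrite -w'E; congr (0 < _).
rewrite /form (partition_big tau predT) //= -sumrB; apply: eq_bigr => j _.
transitivity (v j * sgb (x j)).
  by rewrite mulr_suml; apply: eq_bigr => p /eqP <-; rewrite ffunE.
by case: (x j); rewrite /sgb; lia.
Qed.

End GridFunction.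
End Grid.

(** * Membership and conclusion *)

(** F agrees with a projection on any two points, and majority glues interpolants together. The
    predicate G is abstract so that it can also stand for membership of x0 && g. *)
Lemma baker_pixley (X : finType) (F : {ffun X -> bool} -> bool)
    (G : ({ffun X -> bool} -> bool) -> Prop) :
  (forall z z' : {ffun X -> bool}, (forall p, z p -> z' p) -> F z -> F z') ->
  (forall z, F (compl z) = ~~ F z) ->
  (forall g h, (forall z, g z = h z) -> G g -> G h) ->
  (forall p, G (fun z => z p)) ->
  (forall g h l, G g -> G h -> G l -> G (fun z => maj3 (g z) (h z) (l z))) ->
  G F.
Proof.
move=> Fmono Fdual Gext Gproj Gmaj.
have pair (a b : {ffun X -> bool}) : exists p, a p = F a /\ b p = F b.
  (* Complement if necessary to get true points. Two true points share an element, as otherwise one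
     lies below the complement of the other, which is a false point. *)
  pose up c : {ffun X -> bool} := if F c then c else compl c.
  have upF c : F (up c) by rewrite /up; case Fc: (F c); rewrite ?Fdual Fc.
  have upP c p : up c p -> c p = F c.
    by rewrite /up; case: (F c); rewrite // ffunE => /negPf.
  have [/existsP[p /andP[/upP pa /upP pb]]|/existsPn h] := boolP [exists p, up a p && up b p].
    by exists p.
  suff : F (compl (up b)) by rewrite Fdual upF.
  apply: (Fmono (up a)) => // p ap.
  by have := h p; rewrite ap ffunE.
suff H n (s : seq {ffun X -> bool}) : (size s <= n)%N ->
    exists2 g, G g & {in s, forall z, g z = F z}.
  have [g Gg gF] := H _ (enum {: {ffun X -> bool}}) (leqnn _).
  by apply: Gext Gg => z; apply: gF; rewrite mem_enum.
elim: n s => [|n IH] s.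
  rewrite leqn0 => /nilP ->.
  by have [p _] := pair [ffun=> true] [ffun=> true]; exists (fun z => z p).
case: s => [|a [|b [|c s]]] sn.
- by apply: IH.
- by have [p [pa _]] := pair a a; exists (fun z => z p) => // z; rewrite inE => /eqP ->.
- have [p [pa pb]] := pair a b; exists (fun z => z p) => // z.
  by rewrite !inE => /orP[]/eqP ->.
(* Each interpolant omits one of a, b, c, so at every listed point at least two of the three are
   correct. *)
have [g Gg gF] := IH (b :: c :: s) sn.
have [h Gh hF] := IH (a :: c :: s) sn.
have [l Gl lF] := IH (a :: b :: s) sn.
exists (fun z => maj3 (g z) (h z) (l z)); first exact: Gmaj.
move=> z; rewrite !inE => zs.
have : [\/ g z = F z /\ h z = F z, g z = F z /\ l z = F z | h z = F z /\ l z = F z].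
  case/or4P: zs => zs; [constructor 3|constructor 2|constructor 1|constructor 1];
    by split; first [apply: gF | apply: hF | apply: lF]; rewrite !inE zs ?orbT.
by rewrite /maj3; case=> -[-> ->]; case: (F z); rewrite ?(orbT, orbF, andbF, andbT).
Qed.

Section Embedding.
Variable X : finType.

(** Variable 0 is set aside as the x0 of x0 && F; the others enumerate X. *)
Definition restr (x : bvec #|X|.+1) : {ffun X -> bool} :=
  [ffun p => x (lift ord0 (enum_rank p))].

Definition extend (z : {ffun X -> bool}) : bvec #|X|.+1 :=
  [ffun i => if unlift ord0 i is Some j then z (enum_val j) else true].

Lemma extendK : cancel extend restr.
Proof. by move=> z; apply/ffunP => p; rewrite !ffunE liftK enum_rankK. Qed.

Lemma extend0 z : extend z ord0.
Proof. by rewrite ffunE unlift_none. Qed.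

End Embedding.

(* The flag [b] selects between F itself and x0 && F. *)
Lemma not_determined (R : realType) (C : fclass) (b : bool) : is_clone C ->
  (forall (X : finType) (F : {ffun X -> bool} -> bool),
    (forall z z' : {ffun X -> bool}, (forall p, z p -> z' p) -> F z -> F z') ->
    (forall z, F (compl z) = ~~ F z) ->
    C #|X| [ffun x : bvec #|X|.+1 => (b ==> x ord0) && F (restr x)]) ->
  ~ exists N, determined_by_minors N (fcap C (threshold R)).
Proof.
move=> hC CF [N hN].
have [w [w_pos w_tie w_grow w_gcol]] := grid_weights (2 ^ N.+1).
have Cf := CF _ _ (gfun_mono w_pos) (gfun_compl w).
set f := [ffun x => _] in Cf.
have [|_ Tf] := hN _ f.
  move=> tau; split; first exact: clone_minor_closed.
  apply: int_threshold_threshold.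
  pose tau' p := tau (lift ord0 (enum_rank p)).
  have fE x : minor f tau x = (b ==> x (tau ord0)) && gfun w [ffun p => x (tau' p)].
    rewrite !ffunE; congr (_ && gfun w _).
    by apply/ffunP => p; rewrite !ffunE.
  have gT := gfun_minor w_tie tau' (leqW (leqW (ltnSn _))).
  case: (b) fE => fE.
    have [v [c vE]] := int_threshold_and (tau ord0) gT.
    by exists v, c => x; rewrite fE vE.
  by case: gT => v [c vE]; exists v, c => x; rewrite fE vE.
(* Rows are true points and columns false ones. Each grid point lies on exactly one row and one
   column, so the totals agree. *)
pose a (i : 'I_(2 ^ N.+1).+3) := extend (grow i).
pose a' (j : 'I_(2 ^ N.+1).+3) := extend (gcol j).
apply: (@not_threshold R _ f _ ord0 a a' _ _ _ Tf) => [i|j|p].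
- by rewrite ffunE extend0 implybT extendK gfun_grow.
- by rewrite ffunE extendK negb_and gfun_gcol ?orbT.
have sum1E (c : 'I_(2 ^ N.+1).+3) : (\sum_i (c == i) = 1)%N.
  by rewrite (bigD1 c) //= eqxx big1 // => i; rewrite eq_sym => /negPf ->.
rewrite /a /a'; under eq_bigr do rewrite ffunE; under [RHS]eq_bigr do rewrite ffunE.
case: (unlift ord0 p) => // q.
under eq_bigr do rewrite ffunE; under [RHS]eq_bigr do rewrite ffunE.
by case: (enum_val q) => // -[c d]; rewrite !sum1E.
Qed.

Lemma maj_not_determined (R : realType) (C : fclass) : is_clone C ->
  has_op3 C maj3 -> ~ exists N, determined_by_minors N (fcap C (threshold R)).
Proof.
move=> hC Cm; apply: (@not_determined R C false) => // X F Fmono Fdual.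
apply: (@baker_pixley X F (fun g =>
  C #|X| [ffun x : bvec #|X|.+1 => (false ==> x ord0) && g (restr x)])) => //.
- by move=> g h gh Cg; apply: clone_ext Cg => x; rewrite !ffunE gh.
- by move=> p; apply: clone_ext (hC.1 _ (lift ord0 (enum_rank p))) => x; rewrite !ffunE.
move=> g h l Cg Ch Cl.
by apply: clone_ext (has_op3_app hC Cm Cg Ch Cl) => x; rewrite !ffunE.
Qed.

Lemma and_or_not_determined (R : realType) (C : fclass) : is_clone C ->
  has_op3 C and_or3 -> ~ exists N, determined_by_minors N (fcap C (threshold R)).
Proof.
move=> hC Ca; apply: (@not_determined R C true) => // X F Fmono Fdual.
have app := has_op3_app hC Ca; have x0 := hC.1 #|X| ord0.
apply: (@baker_pixley X F (fun g =>
  C #|X| [ffun x : bvec #|X|.+1 => (true ==> x ord0) && g (restr x)])) => //.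
- by move=> g h gh Cg; apply: clone_ext Cg => x; rewrite !ffunE gh.
- move=> p; pose xp := hC.1 #|X| (lift ord0 (enum_rank p)).
  by apply: clone_ext (app _ _ _ _ x0 xp xp) => x; rewrite !ffunE /and_or3 orbb.
move=> g h l Cg Ch Cl.
(* Majority is (g && (h || l)) || (h && l), here taken below x0. *)
apply: clone_ext (app _ _ _ _ x0 (app _ _ _ _ Cg Ch Cl) (app _ _ _ _ Ch Cl Cl)) => x.
rewrite !ffunE /and_or3 /maj3; case: (x ord0) => //=.
by case: (g _); case: (h _); case: (l _).
Qed.

Theorem theorem2p11 (R : realType) (C : fclass) (hC : is_clone C) :
  finitely_characterizable (fcap C (threshold R)) <->
  (fsub C cloneL \/ fsub C cloneV \/ fsub C cloneLambda).
Proof.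
split=> [/finitely_characterizable_determined Cdet|CLV].
  apply: contrapT => N; case: (post_trichotomy hC).
  - by move=> ?; apply: N; left.
  - by move=> ?; apply: N; right; left.
  - by move=> ?; apply: N; right; right.
  - by move=> Cm; apply: (maj_not_determined hC Cm Cdet).
  - by move=> Ca; apply: (and_or_not_determined hC Ca Cdet).
  move=> Ca; apply: (@and_or_not_determined R _ (dual_is_clone hC) Ca).
  by have [m hm] := Cdet; exists m; apply: determined_dual.
apply: (@determined_finitely_characterizable 2).
  exact: fcap_threshold_minor_closed.
case: CLV => [|[|]]; [exact: determined_sub_cloneL| |exact: determined_sub_cloneLambda].
move=> /sub_cloneV CL n f hf.
have := determined_dual (determined_sub_cloneLambda (R := R) (dual_is_clone hC) CL).
move=> /(_ n f); rewrite /fcap /dual_class dualK; apply=> tau.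
by have := hf tau; rewrite dualK.
Qed.
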